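(* For every Tychonoff space $X$, $w(X)\leq |C(X)|\leq nw(X)^{Nag(X)}$.
   Context: All spaces are Tychonoff; cardinal invariants ($w$ = weight, $nw$ = network weight, etc.) take infinite values. $C(X)$ denotes the set of continuous real-valued functions on $X$. For a Tychonoff space $X$ with Stone–Čech compactification $\beta X$, a family $\mathcal F$ of closed subsets of $\beta X$ separates points of $X$ from $\beta X\setminus X$ if for every $x\in X$ and $y\in\beta X\setminus X$ there is $F\in\mathcal F$ with $x\in F$, $y\notin F$. The Nagami number $Nag(X)$ is the minimal cardinality of such a family $\mathcal F$ (taken to be at least $\omega$). *)

(* Defs.v *)
From Stdlib Require Import Reals List Classical.
Open Scope R_scope.

Record space := Space {
  pt : Type;
  op : (pt -> Prop) -> Prop;
  op_full : op (fun _ => True);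
  op_inter : forall U V, op U -> op V -> op (fun x => U x /\ V x);
  op_union : forall F : (pt -> Prop) -> Prop,
      (forall U, F U -> op U) -> op (fun x => exists U, F U /\ U x)
}.

Definition closed (X : space) (A : pt X -> Prop) : Prop :=
  op X (fun x => ~ A x).

(* continuity of real-valued maps (standard topology of R, generated by
   open intervals) *)
Definition cont_R (X : space) (f : pt X -> R) : Prop :=
  forall a b : R, op X (fun x => a < f x /\ f x < b).

Definition CX (X : space) : Type := { f : pt X -> R | cont_R X f }.

Definition T1 (X : space) : Prop :=
  forall x : pt X, closed X (fun y => y = x).

Definition completely_regular (X : space) : Prop :=
  forall (A : pt X -> Prop) (x : pt X), closed X A -> ~ A x ->
    exists f : pt X -> R, cont_R X f /\ f x = 0 /\ (forall y, A y -> f y = 1).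

Definition tychonoff (X : space) : Prop := T1 X /\ completely_regular X.

Definition hausdorff (X : space) : Prop :=
  forall x y : pt X, x <> y ->
    exists U V, op X U /\ op X V /\ U x /\ V y /\ (forall z, ~ (U z /\ V z)).

Definition compact (X : space) : Prop :=
  forall C : (pt X -> Prop) -> Prop,
    (forall U, C U -> op X U) -> (forall x, exists U, C U /\ U x) ->
    exists l : list (pt X -> Prop),
      (forall U, In U l -> C U) /\ (forall x, exists U, In U l /\ U x).

Definition continuous (X Y : space) (e : pt X -> pt Y) : Prop :=
  forall V, op Y V -> op X (fun x => V (e x)).

Definition embedding (X Y : space) (e : pt X -> pt Y) : Prop :=
  continuous X Y e /\ (forall x x', e x = e x' -> x = x') /\
  (forall U, op X U -> exists V, op Y V /\ forall x, U x <-> V (e x)).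

Definition dense_image (X Y : space) (e : pt X -> pt Y) : Prop :=
  forall V, op Y V -> (exists y, V y) -> exists x, V (e x).

Definition stone_cech (X Y : space) (e : pt X -> pt Y) : Prop :=
  compact Y /\ hausdorff Y /\ embedding X Y e /\ dense_image X Y e /\
  (forall f : pt X -> R, cont_R X f -> (exists M, forall x, Rabs (f x) <= M) ->
     exists g : pt Y -> R, cont_R Y g /\ forall x, g (e x) = f x).

Definition is_base (X : space) (B : (pt X -> Prop) -> Prop) : Prop :=
  (forall U, B U -> op X U) /\
  (forall U x, op X U -> U x -> exists V, B V /\ V x /\ forall z, V z -> U z).

Definition is_network (X : space) (N : (pt X -> Prop) -> Prop) : Prop :=
  forall U x, op X U -> U x -> exists V, N V /\ V x /\ forall z, V z -> U z.

Definition separates (X Y : space) (e : pt X -> pt Y)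
    (F : (pt Y -> Prop) -> Prop) : Prop :=
  (forall A, F A -> closed Y A) /\
  (forall (x : pt X) (y : pt Y), (forall x', e x' <> y) ->
     exists A, F A /\ A (e x) /\ ~ A y).

Definition card_le (A B : Type) : Prop := exists f : A -> B, forall a a', f a = f a' -> a = a'.

(* K represents the cardinal invariant  max(omega, min{ |F| : P F }) *)
Definition is_card_inv {T : Type} (P : ((T -> Prop) -> Prop) -> Prop) (K : Type) : Prop :=
  card_le nat K /\
  (exists F : (T -> Prop) -> Prop, P F /\ card_le {U : T -> Prop | F U} K) /\
  (forall F : (T -> Prop) -> Prop, P F -> card_le K ({U : T -> Prop | F U} + nat)%type).

Definition weight_is (X : space) (K : Type) : Prop := is_card_inv (is_base X) K.
Definition nw_is (X : space) (K : Type) : Prop := is_card_inv (is_network X) K.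
Definition nag_is (X Y : space) (e : pt X -> pt Y) (K : Type) : Prop :=
  is_card_inv (separates X Y e) K.

(* Main.v *)
(* The open sets {f < 1} with f continuous into [0, 1] form a base, so w(X) <= |C(X)|.

   For the upper bound, fix a family F separating X from its remainder in the
   compactification Y, and pick for each pair of members of a network of X two disjoint
   open sets of Y containing them, if possible; these pairs (U_m, V_m) separate the points
   of X.  Given f in C(X), p < q and x in X, extend the truncation of f to Y.  The closed
   sets K1 = {f <= p} and K2 = {f >= q} meet the intersection of the members of F through
   x, which lies in X, in disjoint compact sets.  By compactness there are a finite
   intersection E of members of F through x and disjoint finite lattice combinations U, V
   of the U_m, V_m with the intersection of K1 and E inside U and that of K2 and E inside
   V.  Choosing such a (U, V) for each (E, p, q) determines f: if f x <= p < q <= g x and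
   f, g have the same choices, then x lies in both U and V.  This injects C(X) into the
   maps from finite subsets of F (times a countable set) to finite families of pairs of
   network members, and kappa * kappa = kappa for infinite kappa bounds that by
   nw(X)^Nag(X). *)
From Stdlib Require Import Reals List Classical.
From Stdlib Require Import ClassicalEpsilon FunctionalExtensionality PropExtensionality.
From Stdlib Require Import Bool ZArith Lia Lra.
From mathcomp.classical Require classical_sets.
Require Import Defs.

(** * Zorn's lemma and comparability of cardinals *)

(** The chain [F] may be empty, so the hypothesis includes [P] of the empty set. A user who wants
    [M] to contain a given set has to arrange this through [P]. *)
Lemma zorn_union (T : Type) (P : (T -> Prop) -> Prop) :
  (forall F : (T -> Prop) -> Prop, (forall G, F G -> P G) ->
     (forall G G', F G -> F G' ->
        (forall x, G x -> G' x) \/ (forall x, G' x -> G x)) ->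
     P (fun x => exists G, F G /\ G x)) ->
  exists M, P M /\ forall G, P G -> (forall x, M x -> G x) -> forall x, G x -> M x.
Proof.
  intros HP.
  destruct (@classical_sets.Zorn_bigcup T P) as [M [PM Mmax]].
  - intros F FP Ftot.
    replace (classical_sets.bigcup F (fun G => G))
      with (fun x => exists G, F G /\ G x).
    + apply HP; [exact FP | exact Ftot].
    + apply functional_extensionality; intros x; apply propositional_extensionality.
      split; [intros [G [FG Gx]]; now exists G | intros [G FG Gx]; now exists G].
  - exists M; split; [exact PM|]. intros G PG MG x Gx. apply NNPP; intros nMx.
    apply (Mmax G); [|exact PG]. split; [exact MG|].
    intros GM; apply nMx, GM, Gx.
Qed.

Lemma chain_union_pair (T : Type) (F : (T -> Prop) -> Prop) (x y : T) :
  (forall G G', F G -> F G' ->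
     (forall z, G z -> G' z) \/ (forall z, G' z -> G z)) ->
  (exists G, F G /\ G x) -> (exists G, F G /\ G y) ->
  exists G, F G /\ G x /\ G y.
Proof.
  intros tot [G [FG Gx]] [G' [FG' Gy]].
  destruct (tot G G' FG FG') as [le|le]; [exists G' | exists G]; auto.
Qed.

Lemma card_le_trans (A B C : Type) : card_le A B -> card_le B C -> card_le A C.
Proof.
  intros [f Hf] [g Hg]. exists (fun a => g (f a)). auto.
Qed.

Lemma card_le_of_rel (A B : Type) (Q : A -> B -> Prop) :
  (forall a, exists b, Q a b) ->
  (forall a a' b, Q a b -> Q a' b -> a = a') -> card_le A B.
Proof.
  intros tot inj.
  exists (fun a => proj1_sig (constructive_indefinite_description _ (tot a))).
  intros a a' E.
  pose proof (proj2_sig (constructive_indefinite_description _ (tot a))) as H.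
  pose proof (proj2_sig (constructive_indefinite_description _ (tot a'))) as H'.
  cbv beta in H, H'. rewrite E in H. exact (inj _ _ _ H H').
Qed.

Lemma card_le_prod (A B C D : Type) :
  card_le A C -> card_le B D -> card_le (A * B) (C * D).
Proof.
  intros [f Hf] [g Hg]. exists (fun p => (f (fst p), g (snd p))).
  intros [a b] [a' b'] E; simpl in E; injection E as E1 E2.
  now rewrite (Hf _ _ E1), (Hg _ _ E2).
Qed.

(** A maximal partial injection from [A] to [B] is total or onto; otherwise a pair of missed points
    could be added to its graph. *)
Lemma card_le_total (A B : Type) : card_le A B \/ card_le B A.
Proof.
  pose (P := fun G : A * B -> Prop => forall a b a' b',
    G (a, b) -> G (a', b') -> (a = a' <-> b = b')).
  destruct (zorn_union (A * B) P) as [M [PM Mmax]].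
  { intros F FP tot a b a' b' H H'.
    destruct (chain_union_pair _ F _ _ tot H H') as [G [FG [Gx Gy]]].
    exact (FP G FG _ _ _ _ Gx Gy). }
  destruct (classic (forall a, exists b, M (a, b))) as [T|nT].
  - left. apply (card_le_of_rel A B (fun a b => M (a, b))); [exact T|].
    intros a a' b H H'. now apply (PM a b a' b H H').
  - right. apply not_all_ex_not in nT as [a0 na0].
    apply (card_le_of_rel B A (fun b a => M (a, b))).
    + intros b. apply NNPP; intros nb. apply na0. exists b.
      apply (Mmax (fun z => M z \/ z = (a0, b))); [|now left|now right].
      intros x y x' y' [H|H] [H'|H'].
      * exact (PM _ _ _ _ H H').
      * injection H' as -> ->. split; intros ->; exfalso; eauto.
      * injection H as -> ->. split; intros <-; exfalso; eauto.
      * injection H as -> ->. injection H' as -> ->. tauto.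
    + intros b b' a H H'. now apply (PM a b a b' H H').
Qed.

(** * Squares, lists and powers of infinite cardinals *)

(** A positive integer determines its power of two and its odd part. *)
Lemma nat_square_le : card_le (nat * nat) nat.
Proof.
  exists (fun p => (2 ^ fst p * (2 * snd p + 1))%nat).
  intros [a b] [a' b']; simpl fst; simpl snd.
  revert a'; induction a as [|a IH]; intros [|a'] E.
  - f_equal; simpl in E; lia.
  - exfalso. rewrite Nat.pow_succ_r' in E. simpl (2 ^ 0)%nat in E. lia.
  - exfalso. rewrite Nat.pow_succ_r' in E. simpl (2 ^ 0)%nat in E. lia.
  - rewrite !Nat.pow_succ_r' in E.
    assert (E' : (2 ^ a * (2 * b + 1) = 2 ^ a' * (2 * b' + 1))%nat) by nia.
    specialize (IH a' E'). injection IH as -> ->. reflexivity.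
Qed.

(* Zorn's lemma is applied to graphs of injections S * S -> S with S a subset of A. *)
Section Square.
Variable A : Type.

(** The set S is read off the diagonal of the graph instead of being carried along, so Zorn's lemma
    needs to handle graphs only. *)
Definition sq_dom (G : A * A * A -> Prop) (a : A) : Prop := exists c, G (a, a, c).

Definition sq_graph (G : A * A * A -> Prop) : Prop :=
  (forall a b c c', G (a, b, c) -> G (a, b, c') -> c = c') /\
  (forall a b a' b' c, G (a, b, c) -> G (a', b', c) -> a = a' /\ b = b') /\
  (forall a b c, G (a, b, c) -> sq_dom G a /\ sq_dom G b /\ sq_dom G c) /\
  (forall a b, sq_dom G a -> sq_dom G b -> exists c, G (a, b, c)).

Lemma sq_graph_chain (F : (A * A * A -> Prop) -> Prop) :
  (forall G, F G -> sq_graph G) ->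
  (forall G G', F G -> F G' ->
     (forall x, G x -> G' x) \/ (forall x, G' x -> G x)) ->
  sq_graph (fun x => exists G, F G /\ G x).
Proof.
  intros FP tot. repeat split.
  - intros a b c c' H H'.
    destruct (chain_union_pair _ F _ _ tot H H') as [G [FG [Gx Gy]]].
    apply (proj1 (FP G FG) _ _ _ _ Gx Gy).
  - destruct (chain_union_pair _ F _ _ tot H H0) as [G [FG [Gx Gy]]].
    apply (proj1 (proj2 (FP G FG)) _ _ _ _ _ Gx Gy).
  - destruct (chain_union_pair _ F _ _ tot H H0) as [G [FG [Gx Gy]]].
    apply (proj1 (proj2 (FP G FG)) _ _ _ _ _ Gx Gy).
  - destruct H as [G [FG Gx]].
    destruct (FP G FG) as [_ [_ [H3 _]]].
    destruct (H3 _ _ _ Gx) as [[u Hu] _]. exists u; eauto.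
  - destruct H as [G [FG Gx]].
    destruct (FP G FG) as [_ [_ [H3 _]]].
    destruct (H3 _ _ _ Gx) as [_ [[u Hu] _]]. exists u; eauto.
  - destruct H as [G [FG Gx]].
    destruct (FP G FG) as [_ [_ [H3 _]]].
    destruct (H3 _ _ _ Gx) as [_ [_ [u Hu]]]. exists u; eauto.
  (* A value at [(a, b)] needs one member of the chain whose domain contains both points; the two
     diagonal triples lie in a common member. *)
  - intros a b [u Hu] [v Hv].
    destruct (chain_union_pair _ F _ _ tot Hu Hv) as [G [FG [Gx Gy]]].
    destruct (FP G FG) as [_ [_ [_ H4]]].
    destruct (H4 a b) as [c Hc]; [now exists u | now exists v |].
    exists c; eauto.
Qed.

Lemma sq_graph_square_le (G : A * A * A -> Prop) :
  sq_graph G -> card_le ({a | sq_dom G a} * {a | sq_dom G a}) {a | sq_dom G a}.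
Proof.
  intros [H1 [H2 [H3 H4]]].
  apply (card_le_of_rel _ _ (fun p c =>
    G (proj1_sig (fst p), proj1_sig (snd p), proj1_sig c))).
  - intros [[a Ha] [b Hb]]; simpl. destruct (H4 a b Ha Hb) as [c Hc].
    exists (exist _ c (proj2 (proj2 (H3 _ _ _ Hc)))). exact Hc.
  - intros [[a Ha] [b Hb]] [[a' Ha'] [b' Hb']] [c Hc]; simpl. intros K K'.
    destruct (H2 _ _ _ _ _ K K') as [E1 E2].
    f_equal; apply eq_sig_hprop; simpl; auto; intros; apply proof_irrelevance.
Qed.

(* An injective copy h(S) of S outside S makes room for the new values needed to
   pass from S to the union of S and h(S). *)
Lemma sq_graph_extend (G : A * A * A -> Prop) :
  sq_graph G -> card_le nat {a | sq_dom G a} ->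
  card_le {a | sq_dom G a} {a | ~ sq_dom G a} ->
  exists G', sq_graph G' /\ (forall x, G x -> G' x) /\ exists x, G' x /\ ~ G x.
Proof.
  intros HG [i Hi] [h Hh].
  destruct (sq_graph_square_le G HG) as [f Hf].
  destruct HG as [H1 [H2 [H3 H4]]].
  set (S := {a | sq_dom G a}) in *.
  (* [val] enumerates the union of S and h(S) without repetition, the flag telling the copy. *)
  pose (val := fun (s : S) (b : bool) =>
    if b then proj1_sig (h s) else proj1_sig s).
  assert (valin : forall s, sq_dom G (val s false)) by (intros s; exact (proj2_sig s)).
  assert (valout : forall s, ~ sq_dom G (val s true)) by (intros s; exact (proj2_sig (h s))).
  assert (val_inj : forall s b s' b', val s b = val s' b' -> s = s' /\ b = b').
  { intros s [|] s' [|] E.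
    - split; [|reflexivity]. apply Hh, eq_sig_hprop; [intros; apply proof_irrelevance|exact E].
    - exfalso. apply (valout s). rewrite E. apply valin.
    - exfalso. apply (valout s'). rewrite <- E. apply valin.
    - split; [|reflexivity]. apply eq_sig_hprop; [intros; apply proof_irrelevance|exact E]. }
  assert (dom_val : forall a, sq_dom G a -> exists s, a = val s false).
  { intros a Ha. now exists (exist _ a Ha). }
  (* Four distinct elements of S, one for each pair of flags, let [k] inject all pairs from the
     enlarged set into S. *)
  pose (code := fun b b' : bool => i ((if b then 1 else 0) + (if b' then 2 else 0))%nat).
  assert (code_inj : forall b b' c c', code b b' = code c c' -> b = c /\ b' = c').
  { intros b b' c c' E. apply Hi in E. destruct b, b', c, c'; simpl in E; auto; discriminate. }
  pose (k := fun s b s' b' => f (f (s, s'), code b b')).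
  assert (k_inj : forall s b s' b' t c t' c', k s b s' b' = k t c t' c' ->
            s = t /\ b = c /\ s' = t' /\ b' = c').
  { intros s b s' b' t c t' c' E. apply Hf in E. injection E as E E'.
    apply Hf in E. injection E as -> ->. apply code_inj in E' as [-> ->]. auto. }
  (* Only pairs not already in S * S get a new value, and it is taken in h(S), hence differs from
     every old value. *)
  pose (New := fun x : A * A * A => exists s b s' b', (b || b')%bool = true /\
    x = (val s b, val s' b', val (k s b s' b') true)).
  assert (newdom : forall s b, sq_dom (fun x => G x \/ New x) (val s b)).
  { intros s [|].
    - exists (val (k s true s true) true). right. exists s, true, s, true. auto.
    - destruct (valin s) as [c Hc]. exists c. now left. }
  assert (domnew : forall a, sq_dom (fun x => G x \/ New x) a -> exists s b, a = val s b).
  { intros a [c [Hc|[s [b [s' [b' [_ E]]]]]]].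
    - destruct (dom_val a) as [s Hs]; [now exists c|eauto].
    - injection E as -> _ _. eauto. }
  exists (fun x => G x \/ New x). split; [|split].
  - split; [|split; [|split]].
    + intros a b c c' [H|[s [u [s' [u' [Hu E]]]]]] [H'|[t [v [t' [v' [Hv E']]]]]].
      * exact (H1 _ _ _ _ H H').
      * exfalso. injection E' as -> -> ->. destruct (H3 _ _ _ H) as [Ha [Hb _]].
        destruct v; [exact (valout _ Ha)|]. destruct v'; [exact (valout _ Hb)|discriminate].
      * exfalso. injection E as -> -> ->. destruct (H3 _ _ _ H') as [Ha [Hb _]].
        destruct u; [exact (valout _ Ha)|]. destruct u'; [exact (valout _ Hb)|discriminate].
      * injection E as -> -> ->. injection E' as E1 E2 ->.
        apply val_inj in E1 as [-> ->]. apply val_inj in E2 as [-> ->]. reflexivity.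
    + intros a b a' b' c [H|[s [u [s' [u' [Hu E]]]]]] [H'|[t [v [t' [v' [Hv E']]]]]].
      * exact (H2 _ _ _ _ _ H H').
      * exfalso. injection E' as _ _ ->. destruct (H3 _ _ _ H) as [_ [_ Hc]].
        exact (valout _ Hc).
      * exfalso. injection E as _ _ ->. destruct (H3 _ _ _ H') as [_ [_ Hc]].
        exact (valout _ Hc).
      * injection E as -> -> ->. injection E' as -> -> E3.
        apply (val_inj _ true _ true) in E3 as [E3 _]. apply k_inj in E3 as [-> [-> [-> ->]]]. auto.
    + intros a b c [H|[s [u [s' [u' [Hu E]]]]]].
      * destruct (H3 _ _ _ H) as [[x Hx] [[y Hy] [z Hz]]].
        split; [exists x|split; [exists y|exists z]]; now left.
      * injection E as -> -> ->. exact (conj (newdom _ _) (conj (newdom _ _) (newdom _ true))).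
    + intros a b Ha Hb.
      destruct (domnew a Ha) as [s [u ->]], (domnew b Hb) as [s' [u' ->]].
      destruct (orb u u') eqn:E.
      * exists (val (k s u s' u') true). right. exists s, u, s', u'. auto.
      * apply Bool.orb_false_iff in E as [-> ->].
        destruct (H4 _ _ (valin s) (valin s')) as [c Hc]. exists c. now left.
  - now left.
  - exists (val (i 0%nat) true, val (i 0%nat) true, val (k (i 0%nat) true (i 0%nat) true) true).
    split.
    + right. exists (i 0%nat), true, (i 0%nat), true. auto.
    + intros H. exact (valout _ (proj1 (H3 _ _ _ H))).
Qed.

(** Let S be the domain of a maximal graph. If the complement of S is no larger than S, then A is
    bounded by two copies of S, hence by S * S and by S. Otherwise S embeds in its complement and
    the graph extends, against maximality. *)
Lemma infinite_square_le : card_le nat A -> card_le (A * A) A.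
Proof.
  intros [i Hi]. destruct nat_square_le as [p Hp].
  pose (G0 := fun x : A * A * A => exists m n, x = (i m, i n, i (p (m, n)))).
  assert (G0dom : forall n, sq_dom G0 (i n)) by (intros n; exists (i (p (n, n))), n, n; auto).
  assert (HG0 : sq_graph G0).
  { split; [|split; [|split]].
    - intros a b c c' [m [n E]] [m' [n' E']].
      injection E as -> -> ->. injection E' as E1 E2 ->.
      apply Hi in E1 as ->; apply Hi in E2 as ->; reflexivity.
    - intros a b a' b' c [m [n E]] [m' [n' E']].
      injection E as -> -> ->. injection E' as -> -> E3.
      apply Hi, Hp in E3. injection E3 as -> ->; auto.
    - intros a b c [m [n E]]. injection E as -> -> ->. auto.
    - intros a b [c [m [n E]]] [c' [m' [n' E']]].
      injection E as -> _ _. injection E' as -> _ _. exists (i (p (m, m'))), m, m'; auto. }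
  (* The empty graph has to satisfy [P] because of the empty chain; every nonempty one must contain
     [G0], which makes its domain infinite. Maximality then excludes the empty graph. *)
  pose (P := fun G : A * A * A -> Prop =>
    sq_graph G /\ ((exists x, G x) -> forall x, G0 x -> G x)).
  destruct (zorn_union _ P) as [M [[HM HM0] Mmax]].
  { intros F FP tot. split.
    - apply sq_graph_chain; [intros G FG; apply FP, FG | exact tot].
    - intros [x [G [FG Gx]]] y Hy. exists G. split; [exact FG|].
      apply (proj2 (FP G FG)); eauto. }
  assert (M0 : forall x, G0 x -> M x).
  { apply HM0. apply NNPP; intros nM.
    apply nM. exists (i 0, i 0, i (p (0, 0)))%nat. apply (Mmax G0).
    - split; auto.
    - intros x Mx; exfalso; eauto.
    - now exists 0%nat, 0%nat. }
  assert (Mnat : card_le nat {a | sq_dom M a}).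
  { assert (D : forall n, sq_dom M (i n)).
    { intros n. destruct (G0dom n) as [c Hc]. exists c. auto. }
    exists (fun n => exist _ (i n) (D n)). intros n n' E. apply Hi.
    now injection E. }
  pose proof (sq_graph_square_le M HM) as Msq.
  destruct (card_le_total {a | ~ sq_dom M a} {a | sq_dom M a}) as [le|le].
  - assert (AM : card_le A {a | sq_dom M a}).
    { apply card_le_trans with ({a | sq_dom M a} * {a | sq_dom M a})%type; [|exact Msq].
      destruct le as [h Hh], Mnat as [j Hj].
      (* The second coordinate, [j 0] or [j 1], records whether [a] lies in S or is moved there by
         [h]. *)
      apply (card_le_of_rel _ _ (fun a q =>
        (proj1_sig (fst q) = a /\ snd q = j 0%nat) \/
        (exists H, fst q = h (exist _ a H) /\ snd q = j 1%nat))).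
      - intros a. destruct (classic (sq_dom M a)) as [H|H].
        + exists (exist _ a H, j 0%nat). left; auto.
        + exists (h (exist _ a H), j 1%nat). right; exists H; auto.
      - intros a a' [s t] [[E F]|[H [E F]]] [[E' F']|[H' [E' F']]]; simpl in *; subst.
        + reflexivity.
        + apply Hj in F'; discriminate.
        + apply Hj in F'; discriminate.
        + apply Hh in E'. now injection E'. }
    apply card_le_trans with ({a | sq_dom M a} * {a | sq_dom M a})%type.
    + now apply card_le_prod.
    + apply card_le_trans with {a | sq_dom M a}; [exact Msq|].
      exists (@proj1_sig _ _). intros s s' E. apply eq_sig_hprop; [intros; apply proof_irrelevance|exact E].
  - exfalso. destruct (sq_graph_extend M HM Mnat le) as [G [HG [MG [x [Gx nMx]]]]].
    apply nMx, (Mmax G); [|exact MG|exact Gx].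
    split; [exact HG|]. auto.
Qed.

End Square.

Lemma infinite_prod_le (A B K : Type) :
  card_le nat K -> card_le A K -> card_le B K -> card_le (A * B) K.
Proof.
  intros HK HA HB. apply card_le_trans with (K * K)%type.
  - now apply card_le_prod.
  - now apply infinite_square_le.
Qed.

(** A list is folded into [K] by the pairing [p]. The length is kept as well, since [i 0], the code
    of the empty list, may also be a value of [p]. *)
Lemma infinite_list_le (A K : Type) :
  card_le nat K -> card_le A K -> card_le (list A) K.
Proof.
  intros HK HA.
  destruct (infinite_prod_le A K K HK HA) as [p Hp]; [now exists (fun x => x)|].
  destruct HK as [i Hi].
  apply card_le_trans with (nat * K)%type.
  - exists (fun l => (length l, fold_right (fun a c => p (a, c)) (i 0%nat) l)).
    intros l; induction l as [|a l IH]; intros [|a' l'] E; try discriminate; auto.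
    simpl in E. injection E as E1 E2. apply Hp in E2. injection E2 as -> E2.
    f_equal. apply IH. now rewrite E1, E2.
  - apply infinite_prod_le; [now exists i|now exists i|now exists (fun x => x)].
Qed.

(** Functions are precomposed with a left inverse [r] of [i]; an element of [I] is needed for the
    value of [r] outside the range of [i]. *)
Lemma card_le_arrow (I D L N : Type) :
  inhabited I -> card_le I L -> card_le D N -> card_le (I -> D) (L -> N).
Proof.
  intros inhI [i Hi] [j Hj].
  pose (r := fun l => epsilon inhI (fun x => i x = l)).
  assert (Hr : forall x, r (i x) = x).
  { intros x. apply Hi. apply (epsilon_spec inhI (fun y => i y = i x)). now exists x. }
  exists (fun g l => j (g (r l))). intros g g' E.
  apply functional_extensionality; intros x. apply Hj.
  pose proof (f_equal (fun F => F (i x)) E) as E'; simpl in E'. now rewrite Hr in E'.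
Qed.

(** * Open sets and continuous real-valued functions *)

Lemma op_local (X : space) (U : pt X -> Prop) :
  (forall x, U x -> exists V, op X V /\ V x /\ forall z, V z -> U z) -> op X U.
Proof.
  intros H.
  replace U with (fun x => exists V, (op X V /\ forall z, V z -> U z) /\ V x).
  - apply op_union. now intros V [HV _].
  - apply functional_extensionality; intros x; apply propositional_extensionality.
    split.
    + intros [V [[_ VU] Vx]]. auto.
    + intros Ux. destruct (H x Ux) as [V [HV [Vx VU]]]. eauto.
Qed.

Lemma cont_R_local (X : space) (f : pt X -> R) :
  cont_R X f <-> forall x eps, 0 < eps ->
    exists V, op X V /\ V x /\ forall z, V z -> Rabs (f z - f x) < eps.
Proof.
  split.
  - intros Hf x eps He.
    exists (fun z => f x - eps < f z /\ f z < f x + eps). split; [apply Hf|split].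
    + lra.
    + intros z Hz. apply Rabs_def1; lra.
  - intros Hf a b. apply op_local. intros x Hx.
    destruct (Hf x (Rmin (f x - a) (b - f x))) as [V [HV [Vx HVz]]].
    { apply Rmin_glb_lt; lra. }
    exists V; split; [exact HV|split; [exact Vx|]]. intros z Vz.
    pose proof (HVz z Vz) as D. apply Rabs_def2 in D.
    pose proof (Rmin_l (f x - a) (b - f x)). pose proof (Rmin_r (f x - a) (b - f x)). lra.
Qed.

Lemma cont_R_gt (X : space) (f : pt X -> R) (a : R) :
  cont_R X f -> op X (fun x => a < f x).
Proof.
  intros Hf. apply op_local. intros x Hx.
  exists (fun z => a < f z /\ f z < f x + 1). split; [apply Hf|split]; [lra|tauto].
Qed.

Lemma cont_R_lt (X : space) (f : pt X -> R) (a : R) :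
  cont_R X f -> op X (fun x => f x < a).
Proof.
  intros Hf. apply op_local. intros x Hx.
  exists (fun z => f x - 1 < f z /\ f z < a). split; [apply Hf|split]; [lra|tauto].
Qed.

(** Truncation makes a continuous function bounded, hence extendable to the compactification, while
    keeping the conditions f <= p and q <= f. *)
Definition clamp (p q r : R) : R := Rmax p (Rmin q r).

Lemma clamp_bounds (p q r : R) : p <= q -> p <= clamp p q r <= q.
Proof.
  unfold clamp, Rmax, Rmin. repeat destruct (Rle_dec _ _); lra.
Qed.

Lemma clamp_le (p q r : R) : r <= p -> clamp p q r <= p.
Proof.
  unfold clamp, Rmax, Rmin. repeat destruct (Rle_dec _ _); lra.
Qed.

Lemma clamp_ge (p q r : R) : q <= r -> q <= clamp p q r.
Proof.
  unfold clamp, Rmax, Rmin. repeat destruct (Rle_dec _ _); lra.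
Qed.

Lemma clamp_lipschitz (p q r s : R) : Rabs (clamp p q r - clamp p q s) <= Rabs (r - s).
Proof.
  unfold clamp, Rmax, Rmin, Rabs.
  repeat destruct (Rle_dec _ _); repeat destruct (Rcase_abs _); lra.
Qed.

Lemma cont_R_clamp (X : space) (f : pt X -> R) (p q : R) :
  cont_R X f -> cont_R X (fun x => clamp p q (f x)).
Proof.
  rewrite !cont_R_local. intros Hf x eps He.
  destruct (Hf x eps He) as [V [HV [Vx HVz]]].
  exists V; split; [exact HV|split; [exact Vx|]]. intros z Vz.
  apply Rle_lt_trans with (2 := HVz z Vz). apply clamp_lipschitz.
Qed.

Lemma cont_R_const (X : space) (c : R) : cont_R X (fun _ => c).
Proof.
  apply cont_R_local. intros x eps He. exists (fun _ => True).
  split; [apply op_full|split; [exact I|]]. intros z _.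
  now rewrite Rminus_diag, Rabs_R0.
Qed.

(** * The weight is at most the number of continuous functions *)

(** These are the cozero sets of 1 - f. The range [0, 1] leaves the constants above 1 free for
    another use. *)
Definition cozero_base (X : space) (U : pt X -> Prop) : Prop :=
  exists f, cont_R X f /\ (forall x, 0 <= f x <= 1) /\ U = (fun x => f x < 1).

Lemma cozero_base_is_base (X : space) :
  completely_regular X -> is_base X (cozero_base X).
Proof.
  intros HX. split.
  - intros U [f [Hf [_ ->]]]. now apply cont_R_lt.
  - intros U x HU Ux.
    destruct (HX (fun y => ~ U y) x) as [f [Hf [f0 f1]]].
    + apply op_local. intros z Hz. exists U. apply NNPP in Hz. auto.
    + auto.
    + exists (fun z => clamp 0 1 (f z) < 1). split; [|split].
      * exists (fun z => clamp 0 1 (f z)). split; [now apply cont_R_clamp|split].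
        -- intros z. apply clamp_bounds; lra.
        -- reflexivity.
      * rewrite f0. apply Rle_lt_trans with 0; [apply clamp_le|]; lra.
      * intros z Hz. apply NNPP; intros nU. rewrite (f1 z nU) in Hz.
        pose proof (clamp_ge 0 1 1). lra.
Qed.

(* The constants n + 2 lie outside the functions into [0, 1], so that the summand nat
   of the definition of the weight costs nothing. *)
Lemma weight_le_card_CX (X : space) (W : Type) :
  completely_regular X -> inhabited (pt X) -> weight_is X W -> card_le W (CX X).
Proof.
  intros HX [x0] [_ [_ HW]].
  apply card_le_trans with (1 := HW _ (cozero_base_is_base X HX)).
  apply (card_le_of_rel _ _ (fun s (f : CX X) => match s with
    | inl U => (forall x, 0 <= proj1_sig f x <= 1) /\
               proj1_sig U = (fun x => proj1_sig f x < 1)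
    | inr n => forall x, proj1_sig f x = INR n + 2
    end)).
  - intros [[U [f [Hf HU]]]|n].
    + now exists (exist _ f Hf).
    + now exists (exist _ (fun _ => INR n + 2) (cont_R_const X _)).
  - intros [[U HU]|n] [[U' HU']|n'] [f Hf]; simpl.
    + intros [_ E] [_ E']. subst U'. f_equal.
      apply eq_sig_hprop; [intros; apply proof_irrelevance | exact E].
    + intros [B _] E. specialize (B x0). rewrite E in B. pose proof (pos_INR n'). lra.
    + intros E [B _]. specialize (B x0). rewrite E in B. pose proof (pos_INR n). lra.
    + intros E E'. f_equal. apply INR_eq. specialize (E x0). specialize (E' x0). lra.
Qed.

(** * Compactness and separation of closed sets *)

(** Compactness as an induction principle: a property inherited by subsets and finite unions passes
    from small neighbourhoods of the points of [K] to [K]. *)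
Lemma compact_closed_ind (Y : space) (K : pt Y -> Prop) (Q : (pt Y -> Prop) -> Prop) :
  compact Y -> closed Y K ->
  Q (fun _ => False) ->
  (forall A B, Q A -> Q B -> Q (fun y => A y \/ B y)) ->
  (forall A B : pt Y -> Prop, (forall y, A y -> B y) -> Q B -> Q A) ->
  (forall y, K y -> exists O, op Y O /\ O y /\ Q O) -> Q K.
Proof.
  intros HY HK Q0 QU Qmono Qloc.
  (* The complement of [K] completes the neighbourhoods with [Q] to a cover of the space; it meets
     [K] in the empty set. *)
  destruct (HY (fun O => op Y O /\ (Q O \/ O = fun y => ~ K y))) as [l [Hl cov]].
  - now intros U [HU _].
  - intros y. destruct (classic (K y)) as [Ky|nKy].
    + destruct (Qloc y Ky) as [O [HO [Oy QO]]]. exists O; auto.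
    + exists (fun y => ~ K y); auto.
  - assert (QL : Q (fun y => K y /\ exists O, In O l /\ O y)).
    { clear cov. induction l as [|O l IH].
      - apply Qmono with (2 := Q0). intros y [_ [O [[] _]]].
      - apply Qmono with (fun y => (K y /\ O y) \/ (K y /\ exists O, In O l /\ O y)).
        + intros y [Ky [O' [[<-|HO'] O'y]]]; eauto.
        + apply QU.
          * destruct (Hl O (or_introl eq_refl)) as [_ [QO|E]].
            -- apply Qmono with (2 := QO). tauto.
            -- apply Qmono with (2 := Q0). rewrite E. tauto.
          * apply IH. intros U HU. apply Hl. now right. }
    apply Qmono with (2 := QL). auto.
Qed.

(** Finite subfamilies of [F] are lists, so that [infinite_list_le] bounds their number. *)
Definition all_in {T : Type} {F : (T -> Prop) -> Prop} (E : list {A | F A}) (y : T) : Prop :=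
  forall A, In A E -> proj1_sig A y.

Lemma all_in_app {T : Type} {F : (T -> Prop) -> Prop} (E E' : list {A | F A}) (y : T) :
  all_in (E ++ E') y <-> all_in E y /\ all_in E' y.
Proof.
  unfold all_in. split.
  - intros H. split; intros A HA; apply H, in_or_app; auto.
  - intros [H H'] A HA. apply in_app_or in HA as [HA|HA]; auto.
Qed.

(* A list of lists of indices encodes a finite union of finite intersections of the sets
   U m, and the dual intersection of unions of the sets V m; it is disjoint from the
   former as soon as each U m is disjoint from V m. *)
Definition union_inter {T I : Type} (U : I -> T -> Prop) (d : list (list I)) (y : T) : Prop :=
  exists l, In l d /\ forall m, In m l -> U m y.

Definition inter_union {T I : Type} (V : I -> T -> Prop) (d : list (list I)) (y : T) : Prop :=
  forall l, In l d -> exists m, In m l /\ V m y.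

Lemma union_inter_disjoint {T I : Type} (U V : I -> T -> Prop) (d : list (list I)) (y : T) :
  (forall m z, ~ (U m z /\ V m z)) -> union_inter U d y -> inter_union V d y -> False.
Proof.
  intros dis [l [ld Hl]] HV. destruct (HV l ld) as [m [ml Vm]]. eapply dis; eauto.
Qed.

(** As for disjoint compact sets in a Hausdorff space, compactness is used twice: first over [K2]
    with a point of [K1] fixed, then over [K1]. A point of the remainder is avoided by some member
    of [F] through [x], so only pairs of points of X need the sets [U m], [V m]. *)
Lemma closed_pair_separation (X Y : space) (e : pt X -> pt Y) (F : (pt Y -> Prop) -> Prop)
    (I : Type) (U V : I -> pt Y -> Prop) (K1 K2 : pt Y -> Prop) (x : pt X) :
  compact Y -> separates X Y e F ->
  (forall m, op Y (U m)) -> (forall m, op Y (V m)) ->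
  closed Y K1 -> closed Y K2 ->
  (forall x1 x2, K1 (e x1) -> K2 (e x2) -> exists m, U m (e x1) /\ V m (e x2)) ->
  exists (E : list {A | F A}) d, all_in E (e x) /\
    (forall y, K1 y -> all_in E y -> union_inter U d y) /\
    (forall y, K2 y -> all_in E y -> inter_union V d y).
Proof.
  intros HY [Fcl Fsep] HU HV HK1 HK2 Hsep.
  assert (Q1 : forall x1, K1 (e x1) -> exists O (E : list {A | F A}) l,
    op Y O /\ O (e x1) /\ all_in E (e x) /\
    (forall y, O y -> all_in E y -> forall m, In m l -> U m y) /\
    (forall y, K2 y -> all_in E y -> exists m, In m l /\ V m y)).
  { intros x1 Kx1.
    apply (compact_closed_ind Y K2 (fun B => exists O (E : list {A | F A}) l,
      op Y O /\ O (e x1) /\ all_in E (e x) /\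
      (forall y, O y -> all_in E y -> forall m, In m l -> U m y) /\
      (forall y, B y -> all_in E y -> exists m, In m l /\ V m y)) HY HK2).
    - exists (fun _ => True), nil, nil.
      split; [apply op_full|]. split; [exact Logic.I|]. split; [intros A []|].
      split; [intros y _ _ m []|intros y []].
    - intros A B [O [E [l [HO [Ox [Ex [H1 H2]]]]]]] [O' [E' [l' [HO' [Ox' [Ex' [H1' H2']]]]]]].
      exists (fun y => O y /\ O' y), (E ++ E'), (l ++ l').
      split; [now apply op_inter|]. split; [auto|]. split; [now apply all_in_app|]. split.
      + intros y [Oy Oy'] Hy m Hm. apply all_in_app in Hy as [Hy Hy'].
        apply in_app_or in Hm as [Hm|Hm]; auto.
      + intros y HAB Hy. apply all_in_app in Hy as [Hy Hy'].
        destruct HAB as [Ay|By]; [destruct (H2 y Ay Hy) as [m [Hm Vm]]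
          |destruct (H2' y By Hy') as [m [Hm Vm]]]; exists m; split; auto; apply in_or_app; auto.
    - intros A B AB [O [E [l [HO [Ox [Ex [H1 H2]]]]]]]. exists O, E, l. repeat split; auto.
    - intros y2 Ky2. destruct (classic (exists x2, e x2 = y2)) as [[x2 <-]|ny2].
      + destruct (Hsep x1 x2 Kx1 Ky2) as [m [Um Vm]].
        exists (V m). split; [apply HV|]. split; [exact Vm|].
        exists (U m), nil, (m :: nil). split; [apply HU|]. split; [exact Um|].
        split; [intros A []|]. split.
        * intros y Uy _ m' [<-|[]]. exact Uy.
        * intros y Vy _. exists m. split; [now left|exact Vy].
      + destruct (Fsep x y2) as [A [FA [Ax nAy]]]; [firstorder|].
        (* Adding [A] to the list makes the condition on this neighbourhood vacuous. *)
        exists (fun y => ~ A y). split; [apply (Fcl A FA)|]. split; [exact nAy|].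
        exists (fun _ => True), (exist _ A FA :: nil), nil.
        split; [apply op_full|]. split; [exact Logic.I|].
        split; [intros A' [<-|[]]; exact Ax|]. split.
        * intros y _ _ m [].
        * intros y nAy' HA. exfalso. apply nAy'. exact (HA _ (or_introl eq_refl)). }
  apply (compact_closed_ind Y K1 (fun B => exists (E : list {A | F A}) d, all_in E (e x) /\
    (forall y, B y -> all_in E y -> union_inter U d y) /\
    (forall y, K2 y -> all_in E y -> inter_union V d y)) HY HK1).
  - exists nil, nil. split; [intros A []|]. split; [intros y []|intros y _ _ l []].
  - intros A B [E [d [Ex [H1 H2]]]] [E' [d' [Ex' [H1' H2']]]].
    exists (E ++ E'), (d ++ d'). split; [now apply all_in_app|]. split.
    + intros y HAB Hy. apply all_in_app in Hy as [Hy Hy'].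
      destruct HAB as [Ay|By]; [destruct (H1 y Ay Hy) as [l [Hl Ul]]
        |destruct (H1' y By Hy') as [l [Hl Ul]]]; exists l; split; auto; apply in_or_app; auto.
    + intros y Ky Hy l Hl. apply all_in_app in Hy as [Hy Hy'].
      apply in_app_or in Hl as [Hl|Hl]; [apply (H2 y) | apply (H2' y)]; auto.
  - intros A B AB [E [d [Ex [H1 H2]]]]. exists E, d. auto.
  - intros y1 Ky1. destruct (classic (exists x1, e x1 = y1)) as [[x1 <-]|ny1].
    + destruct (Q1 x1 Ky1) as [O [E [l [HO [Ox [Ex [H1 H2]]]]]]].
      exists O. split; [exact HO|]. split; [exact Ox|].
      (* The list found for [x1] becomes one intersection of sets [U m]; unions over [K1] then
         concatenate such lists. *)
      exists E, (l :: nil). split; [exact Ex|]. split.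
      * intros y Oy Hy. exists l. split; [now left|]. eauto.
      * intros y Ky Hy l' [<-|[]]. eauto.
    + destruct (Fsep x y1) as [A [FA [Ax nAy]]]; [firstorder|].
      exists (fun y => ~ A y). split; [apply (Fcl A FA)|]. split; [exact nAy|].
      exists (exist _ A FA :: nil), nil.
      split; [intros A' [<-|[]]; exact Ax|]. split.
      * intros y nAy' HA. exfalso. apply nAy'. exact (HA _ (or_introl eq_refl)).
      * intros y _ _ l [].
Qed.

(** * Coding continuous functions by a network and a separating family *)

(** Choosing the open sets by pairs of network members, not of points, bounds their number. Disjoint
    neighbourhoods of two distinct points contain the images of network members around them, so that
    pair of members has a good choice. *)
Lemma network_separating_pairs (X Y : space) (e : pt X -> pt Y) (N : (pt X -> Prop) -> Prop) :
  hausdorff Y -> continuous X Y e -> (forall x x', e x = e x' -> x = x') -> is_network X N ->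
  exists U V : {A | N A} * {A | N A} -> pt Y -> Prop,
    (forall m, op Y (U m)) /\ (forall m, op Y (V m)) /\
    (forall m y, ~ (U m y /\ V m y)) /\
    forall x x', x <> x' -> exists m, U m (e x) /\ V m (e x').
Proof.
  intros HY econt einj HN.
  pose (good := fun (m : {A | N A} * {A | N A}) (p : (pt Y -> Prop) * (pt Y -> Prop)) =>
    (forall x, proj1_sig (fst m) x -> fst p (e x)) /\
    (forall x, proj1_sig (snd m) x -> snd p (e x))).
  pose (dis := fun p : (pt Y -> Prop) * (pt Y -> Prop) =>
    op Y (fst p) /\ op Y (snd p) /\ forall y, ~ (fst p y /\ snd p y)).
  assert (H : forall m, exists p, dis p /\ ((exists p', dis p' /\ good m p') -> good m p)).
  { intros m. destruct (classic (exists p', dis p' /\ good m p')) as [[p [Hp Hg]]|no].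
    - now exists p.
    (* Two empty sets keep openness and disjointness for pairs that cannot be separated. *)
    - exists (fun _ => False, fun _ => False). split; [|tauto].
      assert (O : op Y (fun _ => False)) by (apply op_local; intros x []).
      repeat split; auto. simpl. tauto. }
  pose (s := fun m => proj1_sig (constructive_indefinite_description _ (H m))).
  assert (Hs : forall m, dis (s m) /\ ((exists p', dis p' /\ good m p') -> good m (s m))).
  { intros m. exact (proj2_sig (constructive_indefinite_description _ (H m))). }
  exists (fun m => fst (s m)), (fun m => snd (s m)).
  split; [intros m; apply (Hs m)|]. split; [intros m; apply (Hs m)|].
  split; [intros m; apply (Hs m)|].
  intros x x' ne.
  destruct (HY (e x) (e x')) as [U [V [HU [HV [Ux [Vx D]]]]]]; [auto|].
  destruct (HN _ x (econt U HU) Ux) as [A [NA [Ax AU]]].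
  destruct (HN _ x' (econt V HV) Vx) as [B [NB [Bx BV]]].
  exists (exist _ A NA, exist _ B NB).
  destruct (proj2 (Hs (exist _ A NA, exist _ B NB))) as [G1 G2].
  - exists (U, V). repeat split; auto.
  - split; [apply G1, Ax|apply G2, Bx].
Qed.

(** Countably many pairs of thresholds suffice: neighbouring points of the grid of mesh 1/n, with
    the integer numerator written as a difference of naturals. *)
Lemma between_fractions (a b : R) : a < b -> exists n i j : nat,
  a <= (INR i - INR j) / INR n /\ (INR i - INR j) / INR n < (INR i - INR j + 1) / INR n /\
  (INR i - INR j + 1) / INR n <= b.
Proof.
  intros ab.
  (* With a mesh below half of b - a, the first grid point above a and its successor are both at
     most b. *)
  destruct (INR_unbounded (2 / (b - a))) as [n Hn].
  assert (Hpos : 0 < 2 / (b - a)) by (apply Rdiv_lt_0_compat; lra).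
  assert (n0 : 0 < INR n) by lra.
  assert (Hn' : 2 < INR n * (b - a)).
  { apply Rmult_lt_compat_r with (r := b - a) in Hn; [|lra].
    replace (2 / (b - a) * (b - a)) with 2 in Hn by (field; lra). exact Hn. }
  destruct (archimed (INR n * a)) as [H1 H2].
  set (k := up (INR n * a)) in *.
  assert (Hk : INR (Z.to_nat k) - INR (Z.to_nat (- k)) = IZR k).
  { destruct (Z.le_ge_cases 0 k).
    - replace (Z.to_nat (- k)) with 0%nat by lia.
      rewrite (INR_IZR_INZ (Z.to_nat k)), Z2Nat.id by lia. simpl. ring.
    - replace (Z.to_nat k) with 0%nat by lia.
      rewrite (INR_IZR_INZ (Z.to_nat (- k))), Z2Nat.id by lia.
      rewrite opp_IZR. simpl. ring. }
  exists n, (Z.to_nat k), (Z.to_nat (- k)). rewrite Hk. repeat split.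
  - apply Rmult_le_reg_l with (INR n); [exact n0|].
    replace (INR n * (IZR k / INR n)) with (IZR k) by (field; lra). lra.
  - apply Rmult_lt_reg_l with (INR n); [exact n0|].
    replace (INR n * (IZR k / INR n)) with (IZR k) by (field; lra).
    replace (INR n * ((IZR k + 1) / INR n)) with (IZR k + 1) by (field; lra). lra.
  - apply Rmult_le_reg_l with (INR n); [exact n0|].
    replace (INR n * ((IZR k + 1) / INR n)) with (IZR k + 1) by (field; lra). lra.
Qed.

Lemma card_CX_le (X Y : space) (e : pt X -> pt Y) (N : (pt X -> Prop) -> Prop)
    (F : (pt Y -> Prop) -> Prop) :
  stone_cech X Y e -> is_network X N -> separates X Y e F ->
  card_le (CX X) (list {A | F A} * (nat * (nat * nat)) -> list (list ({A | N A} * {A | N A}))).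
Proof.
  intros [HcY [HhY [[econt [einj _]] [_ ext]]]] HN HF.
  destruct (network_separating_pairs X Y e N HhY econt einj HN)
    as [U [V [HU [HV [dis Hsep]]]]].
  pose (low := fun i : list {A | F A} * (nat * (nat * nat)) =>
    (INR (fst (snd (snd i))) - INR (snd (snd (snd i)))) / INR (fst (snd i))).
  pose (high := fun i : list {A | F A} * (nat * (nat * nat)) =>
    (INR (fst (snd (snd i))) - INR (snd (snd (snd i))) + 1) / INR (fst (snd i))).
  (* Only points of X are mentioned, so the extension of the truncated function, which depends on p
     and q, can be forgotten. *)
  pose (sepd := fun (f : pt X -> R) E (p q : R) d => forall x, all_in (F := F) E (e x) ->
    (f x <= p -> union_inter U d (e x)) /\ (q <= f x -> inter_union V d (e x))).
  assert (ex_sepd : forall f x p q, cont_R X f -> p < q ->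
    exists E d, all_in E (e x) /\ sepd f E p q d).
  { intros f x p q Hf pq.
    destruct (ext _ (cont_R_clamp X f p q Hf)) as [g [Hg Eg]].
    { exists (Rmax (Rabs p) (Rabs q)). intros z.
      pose proof (clamp_bounds p q (f z)) as B.
      pose proof (Rmax_l (Rabs p) (Rabs q)). pose proof (Rmax_r (Rabs p) (Rabs q)).
      unfold Rabs in *. repeat destruct (Rcase_abs _); lra. }
    destruct (closed_pair_separation X Y e F _ U V (fun y => g y <= p) (fun y => q <= g y) x)
      as [E [d [Ex [H1 H2]]]]; auto.
    - apply op_local. intros y Hy. exists (fun y => p < g y).
      split; [now apply cont_R_gt|]. split; [lra|intros; lra].
    - apply op_local. intros y Hy. exists (fun y => g y < q).
      split; [now apply cont_R_lt|]. split; [lra|intros; lra].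
    - intros x1 x2 K1 K2. apply Hsep. intros ->. lra.
    - exists E, d. split; [exact Ex|]. intros z Hz. split; intros Hfz.
      + apply H1; [|exact Hz]. rewrite Eg. now apply clamp_le.
      + apply H2; [|exact Hz]. rewrite Eg. now apply clamp_ge. }
  (* A longer list cuts out a smaller set, so separation persists; f and g can therefore be compared
     over one common list. *)
  assert (sepd_app : forall f E E' p q d, sepd f E p q d \/ sepd f E' p q d ->
    sepd f (E ++ E') p q d).
  { intros f E E' p q d [H|H] x Hx; apply H; now apply all_in_app in Hx. }
  pose (code := fun (f : CX X) i =>
    epsilon (inhabits nil) (sepd (proj1_sig f) (fst i) (low i) (high i))).
  exists code.
  assert (not_lt : forall f g x, code f = code g -> ~ proj1_sig f x < proj1_sig g x).
  { intros f g x E lt.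
    destruct (between_fractions _ _ lt) as [n [i [j [B1 [B2 B3]]]]].
    destruct (ex_sepd _ x _ _ (proj2_sig f) B2) as [Ef [df [Efx Hdf]]].
    destruct (ex_sepd _ x _ _ (proj2_sig g) B2) as [Eg [dg [Egx Hdg]]].
    pose (t := (Ef ++ Eg, (n, (i, j)))).
    assert (Sf : sepd (proj1_sig f) (Ef ++ Eg) (low t) (high t) (code f t)).
    { apply epsilon_spec. exists df. apply sepd_app. now left. }
    assert (Sg : sepd (proj1_sig g) (Ef ++ Eg) (low t) (high t) (code g t)).
    { apply epsilon_spec. exists dg. apply sepd_app. now right. }
    (* One code now serves both functions: f x is at most the lower threshold and g x at least the
       upper, which puts the point into two disjoint sets. *)
    rewrite <- E in Sg.
    assert (Hx : all_in (Ef ++ Eg) (e x)) by now apply all_in_app.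
    apply (union_inter_disjoint U V (code f t) (e x) dis).
    - now apply (Sf x Hx).
    - now apply (Sg x Hx). }
  intros f g E. apply eq_sig_hprop; [intros; apply proof_irrelevance|].
  apply functional_extensionality. intros x.
  pose proof (not_lt f g x E). pose proof (not_lt g f x (eq_sym E)). lra.
Qed.

Theorem theorem1 (X : space) (HX : tychonoff X) (Hne : inhabited (pt X))
  (Y : space) (e : pt X -> pt Y) (HY : stone_cech X Y e)
  (W N L : Type) (HW : weight_is X W) (HN : nw_is X N) (HL : nag_is X Y e L) :
  card_le W (CX X) /\ card_le (CX X) (L -> N).
Proof.
  split; [now apply weight_le_card_CX; [apply HX|..]|].
  destruct HN as [N0 [[Net [HNet NetN]] _]], HL as [L0 [[F [HF FL]] _]].
  apply card_le_trans with (1 := card_CX_le X Y e Net F HY HNet HF).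
  (* The exponent is bounded by [L] and the base by [N], as both are infinite and absorb finite
     lists and products. *)
  apply card_le_arrow.
  - exact (inhabits (nil, (0%nat, (0%nat, 0%nat)))).
  - repeat apply infinite_prod_le; try assumption. now apply infinite_list_le.
  - do 2 (apply infinite_list_le; [assumption|]). now apply infinite_prod_le.
Qed.
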